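(* Let $(d_n)_{n\ge1}$ be a bounded sequence of integers $d_n\ge 2$. Then for every set $E\subset[a_0-1;a_0]$ the Hausdorff–Besicovitch dimension of $E$ calculated by means of coverings by nega-$D$-cylinders $\Delta^{-D}_{c_1c_2\ldots c_n}$ is equal to the Hausdorff–Besicovitch dimension of $E$ calculated by means of coverings by closed intervals, i.e. $\dim(E,\Phi_2)=\dim(E,\Phi_1)$, where $\Phi_1$ is the family of all closed intervals and $\Phi_2$ is the family of all nega-$D$-cylinders.
   Context: $A_{d_n}=\{0,1,\dots,d_n-1\}$ and $a_0=\sum_{n=1}^{\infty}\frac{(-1)^{n+1}}{d_1d_2\cdots d_n}$. For digits $\varepsilon_n\in A_{d_n}$ put $\Delta^{-D}_{\varepsilon_1\varepsilon_2\ldots}=\sum_{n=1}^{\infty}\frac{(-1)^n\varepsilon_n}{d_1d_2\cdots d_n}$; every number of $[a_0-1;a_0]$ has such a representation. For $n\ge 1$ and $c_i\in A_{d_i}$, the nega-$D$-cylinder $\Delta^{-D}_{c_1c_2\ldots c_n}$ of rank $n$ is the set of all numbers in $[a_0-1;a_0]$ having a representation $\Delta^{-D}_{\varepsilon_1\varepsilon_2\ldots}$ with $\varepsilon_i=c_i$ for $i=1,\dots,n$. For a family $\Phi$ of subsets of $\mathbb R$, $\alpha>0$ and $\varepsilon>0$ put $$m^{\alpha}_{\varepsilon}(E,\Phi)=\inf\sum_j d^{\alpha}(E_j),$$ where $d(\cdot)$ denotes diameter and the infimum is over all at most countable coverings of $E$ by sets $E_j\in\Phi$ with $d(E_j)\le\varepsilon$.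 The $\alpha$-dimensional measure is $\lim_{\varepsilon\to0}m^{\alpha}_{\varepsilon}(E,\Phi)$, and the dimension $\dim(E,\Phi)$ calculated by means of $\Phi$ is the infimum of all $\alpha>0$ for which this measure is $0$. *)

(* Defs.v *)
From HB Require Import structures.
From mathcomp Require Import all_boot all_order all_algebra.
From mathcomp Require Import all_classical all_reals all_analysis.

Set Implicit Arguments.
Unset Strict Implicit.
Unset Printing Implicit Defensive.

Import Order.TTheory GRing.Theory Num.Theory.
Import numFieldNormedType.Exports.

Local Open Scope classical_set_scope.
Local Open Scope ring_scope.

(* Sequences [d], [e], [c] are indexed from 1; their value at 0 is never
   used. *)

Section NegaD.
Context {R : realType}.
Implicit Types (d e c : nat -> nat) (n : nat).

Definition nega_term d e n : R :=
  (-1) ^+ n * (e n)%:R / (\prod_(1 <= i < n.+1) d i)%N%:R.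

Definition negaD d e : R :=
  limn (fun N => \sum_(1 <= n < N) nega_term d e n).

Definition a0 d : R :=
  limn (fun N => \sum_(1 <= n < N)
    (-1) ^+ n.+1 / (\prod_(1 <= i < n.+1) d i)%N%:R : R).

Definition digits d e : Prop := forall n, (1 <= n)%N -> (e n < d n)%N.

Definition cylinder d n c : set R :=
  [set x | x \in `[a0 d - 1, a0 d] /\
    exists e, [/\ digits d e,
      forall i, (1 <= i <= n)%N -> e i = c i & x = negaD d e]].

Definition closed_intervals : set (set R) :=
  [set A | exists a b : R, a <= b /\ A = `[a, b]%classic].

Definition nega_cylinders d : set (set R) :=
  [set A | exists n c, [/\ (1 <= n)%N,
    forall i, (1 <= i <= n)%N -> (c i < d i)%N & A = cylinder d n c]].

(* The point 0 is adjoined so that the empty set has diameter 0 rather than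
   -oo. *)
Definition diam (A : set R) : \bar R :=
  ereal_sup (0%E |` [set `|x - y|%:E | x in A & y in A]).

(* At most countable coverings are families indexed by a set [J] of natural
   numbers, so finite and empty families are included. *)
Definition covering (Phi : set (set R)) (eps : R) (E : set R)
    (J : set nat) (U : nat -> set R) : Prop :=
  [/\ forall j, J j -> Phi (U j), forall j, J j -> (diam (U j) <= eps%:E)%E &
      E `<=` \bigcup_(j in J) U j].

Definition premeasure (Phi : set (set R)) (alpha eps : R) (E : set R) :
    \bar R :=
  ereal_inf [set s | exists J U, covering Phi eps E J U /\
    s = \esum_(j in J) (diam (U j) `^ alpha)%E].

Definition dim_measure (Phi : set (set R)) (alpha : R) (E : set R) : \bar R :=
  lim (premeasure Phi alpha eps E @[eps --> 0^'+]).

(* Taken in the extended reals, so that the infimum of the empty set is +oo. *)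
Definition dimension (E : set R) (Phi : set (set R)) : \bar R :=
  ereal_inf [set alpha%:E | alpha in
    [set alpha : R | 0 < alpha /\ dim_measure Phi alpha E = 0%E]].

End NegaD.

(* Main.v *)
Require Import Defs.
From mathcomp Require Import all_boot all_order all_algebra.
From mathcomp Require Import all_classical all_reals all_analysis.
From mathcomp Require Import ring lra zify.
Import Order.TTheory GRing.Theory Num.Theory.
Import numFieldNormedType.Exports.
Local Open Scope classical_set_scope.
Local Open Scope ring_scope.

(** The two dimensions agree because, for every exponent [alpha > 0], the
[alpha]-dimensional measure computed with one family vanishes exactly when the
one computed with the other family does.  As premeasures are monotone in
[eps], the measure vanishes if and only if all the premeasures do
([dim_measure_eq0]), and the vanishing of a premeasure passes from a family
[Phi] to a family [Psi] as soon as the part in [E] of each member [A] of [Phi]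
can be covered by a fixed number of members of [Psi] of diameter at most
[eps], each contributing at most [diam A `^ alpha] up to an arbitrarily small
error ([premeasure_refine]).

Going from cylinders to intervals, one interval is enough: if [A] is a nonempty
cylinder, [[inf A, sup A]] has the diameter of [A].  Going from intervals to
cylinders, let [r] be the length of the interval (or a tiny positive number, if
the interval is a point), and [D_n = d_1 ... d_n].  Two expansions with the
same first [n] digits have sums at distance at most [2 / D_n]; take the least
rank [n] with [2 / D_n <= r].  Since the [d_i] are at most [M], this gives [r *
D_n <= 2 M].  The partial sums of order [n] are integer multiples of [1 / D_n],
a cylinder of rank [n] depends on its base only through that multiple, and a
point differs from its partial sum by at most [1 / D_n]. Hence at most [2 M +
3] cylinders of rank [n] are needed to cover what the interval has in common
with [[a_0 - 1, a_0]] ([cover_interval_by_cylinders]).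

The last argument uses that every point of [[a_0 - 1, a_0]] has an expansion
([negaD_surj]).  If [y = x - a_0 + 1] has the Cantor expansion with digits
[c_n], then [x] has the nega-expansion with digits [c_n] for [n] even and
[d_n - 1 - c_n] for [n] odd. *)

(** * Partial sums of nega-D-expansions *)

(** If the increments of [u] are dominated by those of a null sequence [r], then
[u - r] and [u + r] are adjacent sequences, with [u] between them. *)
Lemma telescoping_bound_cvg (R : realType) (u r : nat -> R) :
  (forall n, `|u n.+1 - u n| <= r n - r n.+1) ->
  r n @[n --> \oo] --> (0 : R) ->
  cvgn u /\ forall n, `|limn u - u n| <= r n.
Proof.
move=> ur r0.
have lo : {homo (fun n => u n - r n) : n m / (n <= m)%N >-> n <= m}.
  apply/nondecreasing_seqP => n; have := ur n; rewrite ler_norml => /andP[].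
  lra.
have hi : {homo (fun n => u n + r n) : n m / (n <= m)%N >-> m <= n}.
  apply/nonincreasing_seqP => n; have := ur n; rewrite ler_norml => /andP[].
  lra.
have gap : (((fun n => u n + r n) : R^nat) - ((fun n => u n - r n) : R^nat)) n
    @[n --> \oo] --> (0 : R).
  rewrite (_ : _ - _ = (fun n => r n + r n)); last first.
    by apply/funext => n; rewrite !fctE; lra.
  by rewrite -[X in _ --> X](addr0 0); exact: cvgD.
have [limE cvg_lo cvg_hi] := adjacent_seq lo hi gap.
have cvgu : u n @[n --> \oo] --> limn (fun n => u n - r n).
  apply: (squeeze_cvgr (f := fun n => u n - r n)
                       (h := fun n => u n + r n)) => //.
    near=> n; have : 0 <= r n.
      have := nondecreasing_cvgn_le lo cvg_lo n.
      have := nonincreasing_cvgn_ge hi cvg_hi n.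
      by rewrite limE; lra.
    by move=> rn; apply/andP; split; lra.
  by rewrite -limE.
split; first by apply/cvg_ex; eexists; exact: cvgu.
move=> n; rewrite (cvg_lim _ cvgu)//.
have := nondecreasing_cvgn_le lo cvg_lo n.
have := nonincreasing_cvgn_ge hi cvg_hi n.
by rewrite limE ler_norml => ? ?; apply/andP; split; lra.
Unshelve. all: by end_near. Qed.

(** The product [D_n = d_1 ... d_n]; in particular [D_0 = 1]. *)
Definition cprod (d : nat -> nat) (n : nat) : nat := \prod_(1 <= i < n.+1) d i.

Lemma cprod0 d : cprod d 0 = 1%N.
Proof. by rewrite /cprod big_geq. Qed.

Lemma cprodS d n : cprod d n.+1 = (cprod d n * d n.+1)%N.
Proof. by rewrite /cprod big_nat_recr. Qed.

(** The partial sum of the nega-D-expansion with digits [e] up to and including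
the term of index [n]. *)
Definition nega_sum {R : realType} (d e : nat -> nat) (n : nat) : R :=
  \sum_(1 <= i < n.+1) nega_term d e i.

Lemma nega_sum0 {R : realType} d e : nega_sum d e 0 = 0 :> R.
Proof. by rewrite /nega_sum big_geq. Qed.

Lemma nega_sumS {R : realType} d e n :
  nega_sum d e n.+1 = nega_sum d e n + nega_term d e n.+1 :> R.
Proof. by rewrite /nega_sum big_nat_recr. Qed.

Lemma nega_sum_eq {R : realType} d e e' n :
  (forall i, (1 <= i <= n)%N -> e i = e' i) ->
  nega_sum d e n = nega_sum d e' n :> R.
Proof.
by move=> ee'; apply: eq_big_nat => i /ee' ei; rewrite /nega_term ei.
Qed.

Section Expansion.
Context {R : realType} (d : nat -> nat).
Context (d_ge2 : forall n, (1 <= n)%N -> (2 <= d n)%N).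

Lemma cprod_gtn n : (n < cprod d n)%N.
Proof.
elim: n => [|n IH]; first by rewrite cprod0.
by rewrite cprodS; have := d_ge2 n.+1 isT; nia.
Qed.

Lemma cprod_gt0 n : 0 < (cprod d n)%:R :> R.
Proof. by rewrite ltr0n; exact: leq_trans (cprod_gtn n). Qed.

Lemma cprodV_cvg0 : ((cprod d n)%:R^-1 : R) @[n --> \oo] --> (0 : R).
Proof.
apply: (squeeze_cvgr (f := fun=> 0) (h := @harmonic R)).
- near=> n; apply/andP; split; first by rewrite invr_ge0 ltW ?cprod_gt0.
  by rewrite /harmonic/= lef_pV2 ?posrE ?cprod_gt0 ?ltr0n// ler_nat cprod_gtn.
- exact: cvg_cst.
- exact: cvg_harmonic.
Unshelve. all: by end_near. Qed.

Lemma cprodV_sub n :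
  (cprod d n)%:R^-1 - (cprod d n.+1)%:R^-1 =
  (d n.+1).-1%:R / (cprod d n.+1)%:R :> R.
Proof.
have dn := d_ge2 n.+1 isT.
have dn0 : (d n.+1)%:R != 0 :> R by rewrite pnatr_eq0; lia.
have c0 := lt0r_neq0 (cprod_gt0 n).
rewrite cprodS natrM -subn1 natrB; last by lia.
by field; rewrite dn0.
Qed.

Lemma nega_sum_step e n : digits d e ->
  `|nega_sum d e n.+1 - nega_sum d e n| <=
    (cprod d n)%:R^-1 - (cprod d n.+1)%:R^-1 :> R.
Proof.
move=> de; rewrite nega_sumS addrC addKr cprodV_sub /nega_term.
rewrite !normrM normrX normrN1 expr1n mul1r normr_nat.
rewrite [X in _ * X]ger0_norm ?invr_ge0 ?ler0n//.
rewrite ler_wpM2r ?invr_ge0 ?ler0n// ler_nat.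
by have := de n.+1 isT; lia.
Qed.

Lemma nega_sum_cvg e : digits d e ->
  nega_sum d e n @[n --> \oo] --> (negaD d e : R).
Proof.
move=> de.
have [+ _] :=
  telescoping_bound_cvg _ _ _ (fun n => nega_sum_step e n de) cprodV_cvg0.
move=> /cvg_ex[l ul]; suff -> : negaD d e = l by [].
apply: cvg_lim => //; rewrite -cvg_shiftS; exact: ul.
Qed.

Lemma nega_sum_approx e n : digits d e ->
  `|negaD d e - nega_sum d e n| <= (cprod d n)%:R^-1 :> R.
Proof.
move=> de.
have [_ /(_ n)] :=
  telescoping_bound_cvg _ _ _ (fun n => nega_sum_step e n de) cprodV_cvg0.
by rewrite (cvg_lim _ (nega_sum_cvg e de)).
Qed.

Lemma digits1 : digits d (fun=> 1%N).
Proof. by move=> n /d_ge2. Qed.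

(** Up to sign, [a_0] is the number all of whose digits are 1, so that the
estimates on expansions apply to it. *)
Lemma a0E : a0 d = - negaD d (fun=> 1%N) :> R.
Proof.
apply: cvg_lim => //; rewrite -cvg_shiftS.
rewrite (_ : [sequence _]_n = - (nega_sum d (fun=> 1%N) : nat -> R)).
  exact: (cvgN (nega_sum_cvg _ digits1)).
apply/funext => n; rewrite fctE /nega_sum/= -sumrN.
by apply: eq_bigr => i _; rewrite /nega_term mulr1 exprS; lra.
Qed.

(** Partial sums of order [n] are integer multiples of [1 / D_n]. *)
Lemma nega_sum_int e n :
  exists z : int, nega_sum d e n * (cprod d n)%:R = z%:~R :> R.
Proof.
elim: n => [|n [z IH]]; first by exists 0; rewrite nega_sum0 mul0r.
exists (z * (d n.+1)%:Z + (-1) ^+ n.+1 * (e n.+1)%:Z).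
rewrite rmorphD !rmorphM /= rmorphXn /= rmorphN1 -IH nega_sumS mulrDl.
congr (_ + _); first by rewrite cprodS natrM mulrA.
by rewrite /nega_term -/(cprod d n.+1) divfK// (lt0r_neq0 (cprod_gt0 _)).
Qed.

(** * Existence of expansions *)

(** Cantor expansion of [y], given by the numerators [k n] of its truncations
[k n / D_n]; the digit of index [n + 1] is [k n.+1 - k n * d n.+1]. *)
Lemma cantor_approx (y : R) : 0 <= y <= 1 -> exists k : nat -> nat,
  [/\ k 0%N = 0%N,
      forall n, (k n * d n.+1 <= k n.+1 < (k n).+1 * d n.+1)%N &
      forall n, (k n)%:R / (cprod d n)%:R <= y <= (k n).+1%:R / (cprod d n)%:R].
Proof.
move=> /andP[y0]; rewrite le_eqVlt => /predU1P[->|y1].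
  (* The floors of [y * D_n] would give a first digit [d_1] at [y = 1], so all
     digits are maximal there. *)
  exists (fun n => (cprod d n).-1); split; first by rewrite cprod0.
  - move=> n; rewrite cprodS.
    by have := cprod_gtn n; have := d_ge2 n.+1 isT; nia.
  - move=> n; rewrite prednK ?(leq_trans _ (cprod_gtn n))//.
    rewrite divff ?(lt0r_neq0 (cprod_gt0 n))// lexx andbT.
    by rewrite ler_pdivrMr ?cprod_gt0// mul1r ler_nat leq_pred.
pose t n := Num.truncn (y * (cprod d n)%:R).
have tP n : (t n)%:R <= y * (cprod d n)%:R < (t n).+1%:R.
  by apply: truncn_itv; rewrite mulr_ge0.
exists t; split.
- have /andP[t0 _] := tP 0%N; apply/eqP; rewrite -leqn0 -ltnS -(ltr_nat R).
  by apply: le_lt_trans t0 _; rewrite cprod0 mulr1.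
- move=> n; have /andP[a b] := tP n; have /andP[a' b'] := tP n.+1.
  have dn : 0 < (d n.+1)%:R :> R by rewrite ltr0n; have := d_ge2 n.+1 isT; lia.
  rewrite cprodS natrM mulrA in a' b'.
  apply/andP; split.
  + rewrite -ltnS -(ltr_nat R) natrM; apply: le_lt_trans b'.
    by rewrite ler_pM2r.
  + rewrite -(ltr_nat R) natrM; apply: le_lt_trans a' _.
    by rewrite ltr_pM2r.
- move=> n; have /andP[a b] := tP n.
  by rewrite ler_pdivrMr ?cprod_gt0// a /= ler_pdivlMr ?cprod_gt0// ltW.
Qed.

(** Every point of [[a_0 - 1, a_0]] has a nega-D-expansion. *)
Lemma negaD_surj (x : R) : a0 d - 1 <= x <= a0 d ->
  exists2 e, digits d e & x = negaD d e.
Proof.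
move=> /andP[x0 x1].
have [|k [k0 kS kP]] := cantor_approx (x - a0 d + 1).
  by apply/andP; split; lra.
pose e n := if odd n then (d n - 1 - (k n - k n.-1 * d n))%N
            else (k n - k n.-1 * d n)%N.
have de : digits d e.
  move=> [//|n] _; rewrite /e/=; have := kS n; have := d_ge2 n.+1 isT.
  by case: ifP => _; lia.
exists e => //.
(* The maximal digits at odd positions up to [n] contribute a telescoping sum,
   equal to [-1 - nega_sum d 1 n], up to the term [1 / D_n] for [n] even. *)
have sumE n : nega_sum d e n = (k n)%:R / (cprod d n)%:R - 1
    - nega_sum d (fun=> 1%N) n + (~~ odd n)%:R / (cprod d n)%:R :> R.
  elim: n => [|n IH]; first by rewrite !nega_sum0 k0 cprod0 /=; field.
  rewrite !nega_sumS IH /nega_term -/(cprod d n.+1) cprodS natrM.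
  have dn := d_ge2 n.+1 isT.
  have dn0 : (d n.+1)%:R != 0 :> R by rewrite pnatr_eq0; lia.
  have c0 := lt0r_neq0 (cprod_gt0 n).
  have -> : (k n.+1)%:R = (k n * d n.+1)%:R + (k n.+1 - k n * d n.+1)%:R :> R.
    by rewrite -natrD subnKC//; have /andP[] := kS n.
  rewrite natrM /e /= -[(-1) ^+ n.+1]signr_odd /=.
  case: (odd n) => /=.
    by rewrite expr0; field; rewrite dn0.
  rewrite expr1 natrB; last by have := kS n; lia.
  rewrite natrB; last by lia.
  by field; rewrite dn0.
have lim1 : nega_sum d e n @[n --> \oo] --> x.
  have h c : (x - nega_sum d (fun=> 1%N) n - a0 d + c * (cprod d n)%:R^-1)
      @[n --> \oo] --> x.
    rewrite [X in _ --> X](_ : x = x - negaD d (fun=> 1%N) - a0 d + c * 0).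
      apply: cvgD; last by apply: cvgM; [exact: cvg_cst|exact: cprodV_cvg0].
      apply: cvgB; last exact: cvg_cst.
      by apply: cvgB; [exact: cvg_cst|exact: nega_sum_cvg _ digits1].
    by rewrite a0E; lra.
  apply: (squeeze_cvgr _ (h (-2)) (h 2)); near=> n; rewrite sumE.
  have /andP[+ +] := kP n; rewrite -natr1 mulrDl.
  have : 0 <= (cprod d n)%:R^-1 :> R by rewrite invr_ge0.
  by case: (odd n) => /=; rewrite ?mul0r ?mul1r => *; apply/andP; split; lra.
by rewrite -(cvg_lim _ (nega_sum_cvg e de))// (cvg_lim _ lim1).
Unshelve. all: by end_near. Qed.

End Expansion.

(** * Diameters *)

Section Diameter.
Context {R : realType}.
Implicit Types (A : set R) (r : R).

Lemma diam_ge0 A : (0 <= diam A)%E.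
Proof. by apply: ereal_sup_ubound; left. Qed.

Lemma diam_le A r : 0 <= r -> (forall x y, A x -> A y -> `|x - y| <= r) ->
  (diam A <= r%:E)%E.
Proof.
move=> r0 Ar; apply: ge_ereal_sup => _ [->|[x Ax [y Ay <-]]]; rewrite lee_fin//.
exact: Ar.
Qed.

Lemma le_diam A x y : A x -> A y -> (`|x - y|%:E <= diam A)%E.
Proof.
by move=> Ax Ay; apply: ereal_sup_ubound; right; exists x => //; exists y.
Qed.

Lemma diam_itv (a b : R) : a <= b -> diam `[a, b]%classic = (b - a)%:E.
Proof.
move=> ab; apply/eqP; rewrite eq_le; apply/andP; split.
  apply: diam_le; first by lra.
  move=> x y /=; rewrite !in_itv/= ler_norml => /andP[? ?] /andP[? ?].
  by apply/andP; split; lra.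
rewrite -[(b - a)%R]ger0_norm ?subr_ge0//.
by apply: le_diam; rewrite /= in_itv/= lexx ab.
Qed.

(** A set of finite diameter lies in a closed interval of no larger
diameter. *)
Lemma sub_closed_interval A r : 0 <= r -> (diam A <= r%:E)%E ->
  exists B, [/\ closed_intervals B, (diam B <= diam A)%E & A `<=` B].
Proof.
move=> r0 Ar; have [->|A0] := eqVneq A set0.
  exists `[0, 0]%classic; split => //; first by exists 0, 0.
  by rewrite diam_itv// subr0 diam_ge0.
have /set0P[z Az] := A0.
have Ar' x y : A x -> A y -> x - y <= fine (diam A).
  move=> Ax Ay; rewrite -lee_fin fineK.
    by rewrite (le_trans _ (le_diam _ _ _ Ax Ay))// lee_fin ler_norm.
  by rewrite ge0_fin_numE ?diam_ge0// (le_lt_trans Ar) ?ltry.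
have ubA : has_ubound A.
  by exists (z + fine (diam A)) => x /Ar' /(_ Az); lra.
have lbA : has_lbound A.
  by exists (z - fine (diam A)) => x /(Ar' _ _ Az); lra.
have zi : inf A <= z by apply: ge_inf.
have zs : z <= sup A by apply: ub_le_sup.
exists `[inf A, sup A]%classic; split.
- by exists (inf A), (sup A); split => //; lra.
- rewrite diam_itv; last by lra.
  rewrite -[leRHS]fineK; last first.
    by rewrite ge0_fin_numE ?diam_ge0// (le_lt_trans Ar) ?ltry.
  rewrite lee_fin lerBlDl; apply: ge_sup => [|x Ax]; first by exists z.
  rewrite -lerBlDr; apply: lb_le_inf => [|y Ay]; first by exists z.
  by have := Ar' _ _ Ax Ay; lra.
- by move=> x Ax /=; rewrite in_itv/= ge_inf ?ub_le_sup.
Qed.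

End Diameter.

(** * Covering an interval by few cylinders *)

Section Cylinders.
Context {R : realType} (d : nat -> nat).
Context (d_ge2 : forall n, (1 <= n)%N -> (2 <= d n)%N).

Lemma diam_cylinder n c :
  (diam (cylinder d n c : set R) <= (2 / (cprod d n)%:R)%:E)%E.
Proof.
apply: diam_le; first by rewrite divr_ge0.
move=> x y [_ [e [de ec ->]]] [_ [e' [de' ec' ->]]].
have := nega_sum_approx (R := R) d d_ge2 e n de.
have := nega_sum_approx (R := R) d d_ge2 e' n de'.
rewrite (nega_sum_eq d e e' n); last by move=> i ni; rewrite ec ?ec'.
by rewrite !ler_norml => /andP[? ?] /andP[? ?]; apply/andP; split; lra.
Qed.

(** A cylinder of rank [n] depends on its base only through the partial sum of
order [n]. *)
Lemma mem_cylinder n c e : digits d e ->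
  (forall i, (1 <= i <= n)%N -> (c i < d i)%N) ->
  a0 d - 1 <= (negaD d e : R) <= a0 d ->
  nega_sum d c n = nega_sum d e n :> R ->
  cylinder d n c (negaD d e : R).
Proof.
move=> de dc ae ce; split; first by rewrite in_itv.
pose f i := if (i <= n)%N then c i else e i.
have df : digits d f.
  move=> i i1; rewrite /f; case: ifP => ni; last exact: de.
  by apply: dc; rewrite i1.
exists f; split => //.
  by move=> i /andP[_ ni]; rewrite /f ni.
have fe m : (n <= m)%N -> nega_sum d f m = nega_sum d e m :> R.
  elim: m => [|m IH].
    rewrite leqn0 => /eqP n0; by rewrite !nega_sum0.
  rewrite leq_eqVlt => /predU1P[nm|]; last first.
    rewrite ltnS => nm; rewrite !nega_sumS IH//; congr (_ + _).
    by rewrite /nega_term /f leqNgt ltnS nm.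
  rewrite -nm -ce; apply: nega_sum_eq => i /andP[_ ni]; by rewrite /f ni.
rewrite -(cvg_lim _ (nega_sum_cvg d d_ge2 e de))//.
apply: cvg_lim => //; apply: cvg_trans (nega_sum_cvg d d_ge2 f df).
apply: near_eq_cvg; exists n => // m /= nm; exact: fe.
Qed.

Context (M : nat) (d_le : forall n, (1 <= n)%N -> (d n <= M)%N).

(** The rank [n] of the cylinders adapted to the length [r]: [2 / D_n] is at
most [r], but not smaller by more than a factor [M]. *)
Lemma exists_rank (r : R) : 0 < r <= 1 ->
  exists2 n, (1 <= n)%N & 2 <= r * (cprod d n)%:R <= (2 * M)%:R.
Proof.
move=> /andP[r0 r1].
have ex : exists n, (1 <= n)%N && (2 <= r * (cprod d n)%:R).
  exists (Num.truncn (2 / r)).+1 => /=.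
  rewrite mulrC -ler_pdivrMr// ltW//.
  have /truncn_itv/andP[_ h] : 0 <= 2 / r by rewrite divr_ge0// ltW.
  by apply: lt_trans h _; rewrite ltr_nat cprod_gtn.
(* By minimality [r * D_(n-1) <= 2]; for [n = 1] this follows from [r <= 1]. *)
case: (ex_minnP ex) => -[//|n] /andP[_ n2] nmin; exists n.+1 => //.
rewrite n2 /= cprodS natrM mulrA natrM.
have dM : (d n.+1)%:R <= M%:R :> R by rewrite ler_nat d_le.
have rc : r * (cprod d n)%:R <= 2.
  case: n nmin {n2 dM} => [|n] nmin; first by rewrite cprod0 mulr1; lra.
  rewrite leNgt; apply/negP => /ltW h.
  by have := nmin n.+1; rewrite h => /(_ isT); rewrite ltnn.
by apply: ler_pM => //; rewrite mulr_ge0// ltW.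
Qed.

Lemma cover_interval_by_cylinders (a b r : R) : b - a <= r -> 0 < r <= 1 ->
  exists V : nat -> set R,
    (forall k, nega_cylinders d (V k) /\ (diam (V k) <= r%:E)%E) /\
    `[a, b] `&` `[a0 d - 1, a0 d] `<=` \bigcup_(k in `I_(2 * M + 3)) V k.
Proof.
move=> abr r01; have /andP[r0 _] := r01.
have [n n1 /andP[n2 nM]] := exists_rank r r01.
set D : R := (cprod d n)%:R in n2 nM.
have D0 : 0 < D by exact: cprod_gt0.
pose good (z : int) (c : nat -> nat) :=
  (forall i, (1 <= i <= n)%N -> (c i < d i)%N) /\
  nega_sum d c n * D = z%:~R :> R.
pose z0 := Num.floor (a * D).
(* [c k] is a base of rank [n] with partial sum [(z0 - 1 + k) / D_n], whenever
   there is one, and an arbitrary base otherwise. *)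
have /choice[c cP] : forall k : nat, exists c : nat -> nat,
    (forall i, (1 <= i <= n)%N -> (c i < d i)%N) /\
    ((exists c', good (z0 - 1 + k%:Z) c') -> good (z0 - 1 + k%:Z) c).
  move=> k; have [[c gc]|nc] := pselect (exists c, good (z0 - 1 + k%:Z) c).
    by exists c; split => //; case: gc.
  by exists (fun=> 0%N); split => // i /andP[i1 _]; have := d_ge2 i i1; lia.
exists (fun k => cylinder d n (c k)); split => [k|x].
  split; first by exists n, (c k); split => //; case: (cP k).
  apply: le_trans (diam_cylinder n (c k)) _.
  by rewrite lee_fin ler_pdivrMr.
move=> [/=]; rewrite !in_itv/= => /andP[ax xb] xa.
have [e de xE] := negaD_surj d d_ge2 x xa.
have [z ze] := nega_sum_int (R := R) d d_ge2 e n.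
have : `|x * D - z%:~R| <= 1.
  rewrite -ze -mulrBl normrM [X in _ * X]gtr0_norm// xE.
  by rewrite -ler_pdivlMr// div1r nega_sum_approx.
rewrite ler_norml => /andP[xz zx].
have /andP[fl fu] := floor_itv (a * D); rewrite -/z0 in fl fu.
have aD : a * D <= x * D by rewrite ler_pM2r.
have bD : x * D <= a * D + r * D by rewrite -mulrDl ler_pM2r//; lra.
have zlo : z0 - 1 <= z.
  by rewrite -(ler_int R) rmorphB /=; lra.
have zhi : z < z0 - 1 + (2 * M + 3)%:Z.
  rewrite -(ltr_int R) intrD intrB -pmulrn natrD.
  rewrite rmorphD /= in fu.
  move: nM; lra.
pose k : nat := absz (z - (z0 - 1))%R.
have kE : z0 - 1 + k%:Z = z by rewrite /k gez0_abs ?subr_ge0// addrC subrK.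
exists k; first by rewrite /= -ltz_nat -(ltrD2l (z0 - 1)) kE.
have [dc gc] := cP k.
have [_ cz] : good (z0 - 1 + k%:Z) (c k).
  by apply: gc; exists e; split; [move=> i /andP[i1 _]; exact: de|rewrite kE].
rewrite xE; apply: mem_cylinder => //; first by rewrite -xE.
by apply: (mulIf (lt0r_neq0 D0)); rewrite cz kE ze.
Qed.

End Cylinders.

(** * Vanishing of premeasures *)

Section Premeasure.
Context {R : realType}.
Implicit Types (Phi Psi : set (set R)) (E : set R) (alpha eps : R).

Lemma premeasure_ge0 Phi alpha eps E : (0 <= premeasure Phi alpha eps E)%E.
Proof.
apply: le_ereal_inf_tmp => _ [J [U [_ ->]]].
by apply: esum_ge0 => j _; exact: poweR_ge0.
Qed.

Lemma premeasure_anti Phi alpha eps eps' E : eps <= eps' ->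
  (premeasure Phi alpha eps' E <= premeasure Phi alpha eps E)%E.
Proof.
move=> le_eps; apply: ereal_inf_le_tmp => s [J [U [[PhiU Ueps EU] ->]]].
exists J, U; split => //; split => // j Jj.
by rewrite (le_trans (Ueps _ Jj))// lee_fin.
Qed.

Lemma dim_measure_eq0 Phi alpha E :
  dim_measure Phi alpha E = 0%E <->
  (forall eps, 0 < eps -> premeasure Phi alpha eps E = 0%E).
Proof.
have limE : dim_measure Phi alpha E =
    ereal_sup [set premeasure Phi alpha eps E | eps in `]0%R, +oo[%classic].
  apply: cvg_lim => //; apply: nonincreasing_at_right_cvge => // x y _ _ xy.
  exact: premeasure_anti.
split=> [m0 eps eps0|pre0].
  apply/eqP; rewrite eq_le premeasure_ge0 andbT -m0 limE.
  by apply: ereal_sup_ubound; exists eps => //=; rewrite in_itv/= eps0.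
apply/eqP; rewrite limE eq_le; apply/andP; split.
  by apply: ge_ereal_sup => _ [eps + <-]; rewrite /= in_itv/= andbT => /pre0 ->.
rewrite -(pre0 1 ltr01); apply: ereal_sup_ubound; exists 1 => //=.
by rewrite in_itv/= ltr01.
Qed.

(** Indexing [K] copies of a family over [J] by the numbers [j * K + k] with
[k < K] multiplies its sum by [K]. *)
Lemma esum_divn K (J : set nat) (g : nat -> \bar R) : (0 < K)%N ->
  (forall j, J j -> (0 <= g j)%E) ->
  (\esum_(m in [set m | J (m %/ K)%N]) g (m %/ K)%N =
    (\esum_(j in J) g j) *+ K)%E.
Proof.
move=> K0 g0.
rewrite (@reindex_esum R (nat * nat)%type nat (`I_K `*`` (fun=> J)) _
    (fun p => (p.2 * K + p.1)%N)).
  under eq_esum => p [/= pK _] do rewrite divnMDl// divn_small// addn0.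
  rewrite -(@esum_esum R nat nat `I_K (fun=> J) (fun _ j => g j))//; last first.
    by move=> k j _; exact: g0.
  rewrite esum_fset//; last by move=> k _; exact: esum_ge0.
  rewrite -fsbig_ord/= big_const_ord.
  by elim: (K) => // n IH; rewrite iterS IH muleS.
split.
- by move=> [k j] [/= kK Jj]; rewrite divnMDl// divn_small// addn0.
- move=> [k j] [k' j'] /set_mem[/= kK _] /set_mem[/= kK' _] e.
  have := congr1 (divn^~ K) e; rewrite !divnMDl// !divn_small// !addn0 => jj.
  by move: e; rewrite jj => /addnI ->.
- move=> m /= Jm; exists (m %% K, m %/ K)%N; last by rewrite /= -divn_eq.
  by split => //=; rewrite ltn_mod.
Qed.

(** If every small member of [Phi] can be replaced inside [E] by at most [K]
members of [Psi], with an arbitrarily small loss on each of them, then the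
[Psi]-premeasure of [E] vanishes with the [Phi]-premeasure. *)
Lemma premeasure_refine Phi Psi alpha eps E (K : nat) : (0 < K)%N ->
  (forall A, Phi A -> (diam A <= eps%:E)%E -> forall eta : R, 0 < eta ->
    exists V : nat -> set R,
      (forall k, [/\ Psi (V k), (diam (V k) <= eps%:E)%E &
        (diam (V k) `^ alpha <= diam A `^ alpha + eta%:E)%E]) /\
      A `&` E `<=` \bigcup_(k in `I_K) V k) ->
  premeasure Phi alpha eps E = 0%E -> premeasure Psi alpha eps E = 0%E.
Proof.
move=> K0 refine pre0; apply/eqP; rewrite eq_le premeasure_ge0 andbT.
apply/lee_addgt0Pr => e e0; rewrite add0e.
pose eta := e / (2 * K)%:R.
have eta0 : 0 < eta by rewrite divr_gt0// ltr0n muln_gt0.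
have : (premeasure Phi alpha eps E < eta%:E)%E by rewrite pre0 lte_fin.
move=> /ereal_inf_lt[_ [J [U [[PhiU Ueps EU] ->]]] sum_lt].
(* The errors allowed at the indices [j] add up to at most [eta]. *)
have etaj j : 0 < eta / (2 ^ j.+1)%:R :> R by rewrite divr_gt0// ltr0n expn_gt0.
have /choice[V VP] : forall j, exists V : nat -> set R, J j ->
    (forall k, [/\ Psi (V k), (diam (V k) <= eps%:E)%E &
      (diam (V k) `^ alpha <=
        diam (U j) `^ alpha + (eta / (2 ^ j.+1)%:R)%:E)%E]) /\
    U j `&` E `<=` \bigcup_(k in `I_K) V k.
  move=> j; have [Jj|nJj] := pselect (J j); last by exists (fun=> set0).
  by have [V ?] := refine _ (PhiU _ Jj) (Ueps _ Jj) _ (etaj j); exists V.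
pose g j := (diam (U j) `^ alpha + (eta / (2 ^ j.+1)%:R)%:E)%E.
have g0 j : (0 <= g j)%E by rewrite adde_ge0 ?poweR_ge0// lee_fin ltW.
have gsum : (\esum_(j in J) g j <= (2 * eta)%:E)%E.
  rewrite esumD; last 2 first.
  - by move=> *; exact: poweR_ge0.
  - by move=> j _; rewrite lee_fin ltW.
  rewrite mulr_natl mulr2n EFinD; apply: leeD; first exact: ltW.
  have := epsilon_trick0 (mem J) (ltW eta0).
  rewrite nneseries_esum ?set_mem_set//; by move=> j _; rewrite lee_fin ltW.
apply: (@le_trans _ _ ((\esum_(j in J) g j) *+ K)%E); last first.
  have -> : e%:E = ((2 * eta)%:E *+ K)%E :> \bar R.
    rewrite -EFin_natmul; congr EFin; rewrite /eta natrM -mulr_natr; field.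
    by rewrite pnatr_eq0 -lt0n.
  by elim: (K) => // n IH; rewrite !muleS leeD.
rewrite -(esum_divn K)//.
apply: le_trans; last first.
  apply: le_esum => m Jm; have [/(_ (m %% K)%N)[_ _ h] _] := VP _ Jm; exact: h.
apply: ereal_inf_lbound.
exists [set m | J (m %/ K)%N], (fun m => V (m %/ K)%N (m %% K)%N); split => //.
split.
- by move=> m /= /VP[/(_ (m %% K)%N)[]].
- by move=> m /= /VP[/(_ (m %% K)%N)[]].
- move=> x Ex; have [j Jj Ujx] := EU _ Ex.
  have [_ /(_ x (conj Ujx Ex))[k /= kK Vx]] := VP _ Jj.
  exists (j * K + k)%N => /=; first by rewrite divnMDl// divn_small// addn0.
  by rewrite divnMDl// divn_small// addn0 modnMDl modn_small.
Qed.

End Premeasure.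

(** * Comparison of the two families *)

Section Compare.
Context {R : realType} (d : nat -> nat).

Lemma premeasure_cylinders_intervals (alpha eps : R) E :
  0 < alpha -> 0 < eps ->
  premeasure (nega_cylinders d) alpha eps E = 0%E ->
  premeasure closed_intervals alpha eps E = 0%E.
Proof.
move=> alpha0 eps0.
apply: (premeasure_refine _ _ _ _ _ 1) => // A _ Aeps eta eta0.
have [B [Bitv BA AB]] := sub_closed_interval A eps (ltW eps0) Aeps.
exists (fun=> B); split=> [_|x [Ax _]]; last by exists 0%N => //; exact: AB.
split => //; first exact: le_trans Aeps.
apply: (@le_trans _ _ (diam A `^ alpha)%E); last by rewrite leeDl// lee_fin ltW.
by apply: gt0_ler_poweR; rewrite ?in_itv/= ?diam_ge0 ?leey// ltW.
Qed.

Context (d_ge2 : forall n, (1 <= n)%N -> (2 <= d n)%N).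
Context (M : nat) (d_le : forall n, (1 <= n)%N -> (d n <= M)%N).

Lemma premeasure_intervals_cylinders (alpha eps : R) E :
  E `<=` `[a0 d - 1, a0 d] -> 0 < alpha -> 0 < eps <= 1 ->
  premeasure closed_intervals alpha eps E = 0%E ->
  premeasure (nega_cylinders d) alpha eps E = 0%E.
Proof.
move=> Ea0 alpha0 /andP[eps0 eps1].
apply: (premeasure_refine _ _ _ _ _ (2 * M + 3)).
  by rewrite addn_gt0 orbT.
move=> _ [a [b [ab ->]]] + eta eta0.
rewrite diam_itv// lee_fin => ab_eps.
(* Only a degenerate interval needs a length [r] different from its own: it is
   chosen with [r `^ alpha <= eta]. *)
have [r [r0 abr reps rpow]] : exists r : R, [/\ 0 < r, b - a <= r, r <= eps &
    r `^ alpha <= (b - a) `^ alpha + eta].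
  move: ab; rewrite -subr_ge0 le_eqVlt => /predU1P[<-|ab]; last first.
    by exists (b - a); split => //; lra.
  exists (Num.min eps (eta `^ alpha^-1)).
  have m0 : 0 < Num.min eps (eta `^ alpha^-1) by rewrite lt_min eps0 powR_gt0.
  split => //; [exact: ltW|by rewrite ge_min lexx|].
  rewrite powR0 ?gt_eqF// add0r.
  apply: (@le_trans _ _ ((eta `^ alpha^-1) `^ alpha)).
    apply: ge0_ler_powR; rewrite ?nnegrE ?powR_ge0 ?(ltW m0) ?(ltW alpha0)//.
    by rewrite ge_min lexx orbT.
  by rewrite -powRrM mulVf ?gt_eqF// powRr1// ltW.
have [|V [VP Vcov]] := cover_interval_by_cylinders d d_ge2 M d_le a b r abr.
  by rewrite r0 (le_trans reps).
exists V; split=> [k|x [xab Ex]]; last first.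
  by apply: Vcov; split => //; exact: Ea0.
have [Vcyl Vr] := VP k; split => //.
  by apply: le_trans Vr _; rewrite lee_fin.
apply: (@le_trans _ _ (r%:E `^ alpha)%E).
  apply: gt0_ler_poweR; rewrite ?in_itv/= ?diam_ge0 ?leey ?lee_fin//.
  - exact: ltW.
  - by rewrite ltW.
by rewrite !poweR_EFin -EFinD lee_fin.
Qed.

End Compare.

Theorem theorem9 (R : realType) (d : nat -> nat)
    (d_ge2 : forall n, (1 <= n)%N -> (2 <= d n)%N)
    (d_bounded : exists M : nat, forall n, (1 <= n)%N -> (d n <= M)%N)
    (E : set R) (E_sub : E `<=` `[a0 d - 1, a0 d]) :
  dimension E (nega_cylinders d) = dimension E closed_intervals.
Proof.
have [M d_le] := d_bounded.
congr (ereal_inf (image _ _)); apply/seteqP; split=> alpha [alpha0].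
  move=> /dim_measure_eq0 pre0; split => //; apply/dim_measure_eq0 => eps eps0.
  by apply: premeasure_cylinders_intervals (pre0 _ eps0).
move=> /dim_measure_eq0 pre0; split => //; apply/dim_measure_eq0 => eps eps0.
have eps'0 : 0 < Num.min eps 1 by rewrite lt_min eps0 ltr01.
apply/eqP; rewrite eq_le premeasure_ge0 andbT.
rewrite -(premeasure_intervals_cylinders d d_ge2 M d_le alpha
  (Num.min eps 1) E)//.
- by apply: premeasure_anti; rewrite ge_min lexx.
- by rewrite eps'0 ge_min lexx orbT.
- exact: pre0.
Qed.
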